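(* Let $L>0$ and let $f:\mathbb{R}\to\mathbb{R}$, $f(x)=\tfrac{L}{2}x^2$. For any $\eta\in[2/(3L),\,1/L)$, set $\theta:=1/L-\eta$, and let $(x_n)_{n\ge -1}$ be generated by the two-step scheme $$x_{n+1}=x_n-\eta\,\nabla f(x_n)-\theta\bigl(\nabla f(x_n)-\nabla f(x_{n-1})\bigr),\qquad n\ge0,$$ with initialization $x_{-1}=x_0\neq0$. Then the piecewise-linear interpolation of the sequence $\{f(x_n)\}_{n\ge0}$ is not convex.
   Context: The piecewise-linear interpolation of a real sequence $\{a_n\}_{n\ge0}$ is the continuous function on $[0,\infty)$ that takes the value $a_n$ at each integer $n\ge0$ and is affine on each interval $[n,n+1]$. It is convex if and only if the sequence is convex, i.e. $a_{n+1}-a_n\le a_{n+2}-a_{n+1}$ for all $n\ge0$. In one dimension $\nabla f=f'$. *)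

(* Defs.v *)
From HB Require Import structures.
From mathcomp Require Import all_boot all_order all_algebra.
From mathcomp Require Import all_classical all_reals all_analysis.
From mathcomp Require Import lra.

Set Implicit Arguments.
Unset Strict Implicit.
Unset Printing Implicit Defensive.

Import Order.TTheory GRing.Theory Num.Theory.

Local Open Scope ring_scope.

(* Only meaningful for t >= 0, where Num.truncn t is the integer part of t;
   truncn is 0 on the negative axis. *)
Definition pl_interp (R : realType) (a : nat -> R) (t : R) : R :=
  let n := Num.truncn t in a n + (t - n%:R) * (a n.+1 - a n).

Lemma pl_interp_nat (R : realType) (a : nat -> R) (n : nat) :
  pl_interp a n%:R = a n.
Proof. by rewrite /pl_interp natrK subrr mul0r addr0. Qed.

(* Right endpoint included, so that consecutive affine pieces agree and
   pl_interp a is continuous. *)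
Lemma pl_interp_affine (R : realType) (a : nat -> R) (n : nat) (t : R) :
  n%:R <= t <= n.+1%:R -> pl_interp a t = a n + (t - n%:R) * (a n.+1 - a n).
Proof.
move=> /andP[nt]; rewrite le_eqVlt => /orP[/eqP ->|tn].
  by rewrite pl_interp_nat -natr1; lra.
by rewrite /pl_interp (truncn_def (n := n)) // nt tn.
Qed.

(* Main.v *)
Require Import Defs.
From HB Require Import structures.
From mathcomp Require Import all_boot all_order all_algebra.
From mathcomp Require Import all_classical all_reals all_analysis.
From mathcomp Require Import ring lra.

Import Order.TTheory GRing.Theory Num.Theory.
Import numFieldNormedType.Exports.

Local Open Scope classical_set_scope.
Local Open Scope ring_scope.

(** Since [eta + theta = 1 / L], the coefficient of [x_n] in the scheme vanishes
    and it reads [x_(n+1) = q x_(n-1)] with [q = theta L], so that the iterates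
    are [x_0, q x_0, q x_0, q^2 x_0, ...].  As [0 < q < 1], the values [f (x_n)]
    stay constant from [n = 1] to [n = 2] and strictly decrease from [n = 2] to
    [n = 3], which no convex function does. *)

(** Convexity with weight 1/2 between the nodes [n] and [n.+2]: their midpoint is the node [n.+1],
    and [pl_interp a] agrees with [a] at all three. *)
Lemma convex_pl_interp (R : realType) (a : nat -> R) (n : nat) :
  convex_function (`[0, +oo[ : set R) (pl_interp a) ->
  a n.+1 - a n <= a n.+2 - a n.+1.
Proof.
have h0 : 0 <= 2^-1 :> R by lra.
have h1 : 2^-1 <= 1 :> R by lra.
have memN k : k%:R \in (`[0, +oo[%classic : set R).
  by rewrite inE /= in_itv /= ler0n.
move=> /(_ (Itv01 h0 h1) n%:R n.+2%:R (memN n) (memN n.+2)).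
rewrite !convRE /= /unstable.onem !pl_interp_nat.
rewrite [X in pl_interp a X](_ : _ = n.+1%:R :> R); last first.
  apply: (etrans (convRE (n%:R : R^o) (n.+2%:R : R^o) _)) => /=.
  by rewrite /unstable.onem -(natr1 n.+1) -(natr1 n); lra.
by rewrite pl_interp_nat; lra.
Qed.

Lemma derive1_half_sqr (R : realType) (L y : R) :
  derive1 (fun z : R => L / 2 * z ^+ 2) y = L * y.
Proof.
rewrite derive1Ml; last exact: exprn_derivable.
by rewrite exp_derive1 /= /GRing.scale /= expr1; field.
Qed.

Theorem proposition5p1 (R : realType) (L : R) (hL : 0 < L)
    (f : R -> R) (hf : f = fun y : R => L / 2 * y ^+ 2)
    (eta : R) (heta : 2 / (3 * L) <= eta < 1 / L)
    (theta : R) (htheta : theta = 1 / L - eta)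
    (x : int -> R)
    (hx : forall n : int, 0 <= n ->
      x (n + 1) = x n - eta * derive1 f (x n)
                  - theta * (derive1 f (x n) - derive1 f (x (n - 1))))
    (hinit : x (-1) = x 0) (hx0 : x 0 <> 0) :
  ~ convex_function (`[0, +oo[ : set R)
      (pl_interp (fun n : nat => f (x n%:Z))).
Proof.
move=> /(convex_pl_interp _ _ 1) /=.
have df y : derive1 f y = L * y by rewrite hf derive1_half_sqr.
pose q := theta * L.
have step (n : int) : 0 <= n -> x (n + 1) = q * x (n - 1).
  move=> n0; rewrite hx // !df /q htheta.
  by field; rewrite gt_eqF.
(* The initialization [x (-1) = x 0] is what makes [x 1] and [x 2] coincide. *)
have x1 : x 1 = q * x 0 by rewrite -hinit; exact: (step 0).
have x2 : x 2 = q * x 0 by exact: (step 1).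
have x3 : x 3 = q * x 1 by exact: (step 2).
(* Since [q = 1 - eta * L], the two bounds amount to [eta < 1 / L] and [0 < eta]. *)
have [q0 q1] : 0 < q /\ q < 1.
  case/andP: heta => eta_ge eta_lt.
  have eta_gt0 : 0 < eta.
    by apply: lt_le_trans eta_ge; rewrite divr_gt0 ?mulr_gt0 ?ltr0n.
  split; first by rewrite mulr_gt0 // htheta subr_gt0.
  by rewrite /q htheta mulrBl div1r mulVf ?gt_eqF // gtrBl mulr_gt0.
(* This is [f (x 3) < f (x 2)], whereas convexity at node 2 with [f (x 1) = f (x 2)] forces
   [f (x 2) <= f (x 3)]. *)
have drop : L / 2 * (q * (q * x 0)) ^+ 2 < L / 2 * (q * x 0) ^+ 2.
  rewrite ltr_pM2l ?divr_gt0 ?ltr0n // [ltLHS]exprMn.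
  have qx_gt0 : 0 < (q * x 0) ^+ 2.
    rewrite exprn_even_gt0 //= mulf_eq0 (gt_eqF q0).
    exact/eqP.
  by rewrite gtr_pMl // expr_lt1 // ltW.
by rewrite hf x3 x2 x1; lra.
Qed.
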